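(* Let $\lambda>0$ and $\rho_c=\frac{\lambda}{1+\lambda}$. There exists a sequence $(\alpha_N)_{N\in\mathbb{N}}$, depending only on $\lambda$ and satisfying $\alpha_N=O(\sqrt{N\log N})$ as $N\to\infty$, such that $$\lim_{N\to\infty}\mu^{(N)}\big[\rho_c N-\alpha_N,\ \rho_c N+\alpha_N\big]=1,$$ where $\mu^{(N)}$ is the distribution of the total number of particles under the stationary distribution of the driven activated random walk Markov chain on the complete graph with $N$ non-boundary vertices and sleeping rate $\lambda$.
   Context: Fix the sleeping rate $\lambda>0$. Let $\mathcal{G}_{N+1}$ be the complete graph on $N+1$ vertices (no self-loops, no multiple edges), with one distinguished vertex called the boundary; let $\mathring V_{N+1}$ be the set of the remaining $N$ vertices. Activated random walk (ARW) dynamics (continuous time): particles are active (A) or sleeping (S). Each active particle performs an independent continuous-time simple random walk on $\mathcal{G}_{N+1}$ with jump rate $1$, and carries an independent Poisson clock of rate $\lambda$. When the clock of an active particle rings, the particle becomes sleeping if it does not share its vertex with another active particle; otherwise nothing happens. A sleeping particle does not move, and becomes active as soon as its vertex is visited by an active particle. A particle that jumps to the boundary vertex is instantaneously removed from the system. Driven chain: the state space is $\Sigma=\{0,s\}^{\mathring V_{N+1}}$, where $\xi(x)=s$ means that there is one sleeping particle at $x$ and $\xi(x)=0$ that $x$ is empty. Given $\xi_{n-1}\in\Sigma$, add an active particle at a vertex chosen uniformly at random in $\mathring V_{N+1}$ (if this vertex hosts a sleeping particle, that particle is activated) and run the ARW dynamics until, after an almost surely finite time, all particles remaining in $\mathring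 V_{N+1}$ are sleeping; the resulting configuration is $\xi_n\in\Sigma$. The Markov chain $(\xi_n)_{n\ge0}$ is irreducible and aperiodic on the finite set $\Sigma$; let $\bar\mu^{(N)}$ be its unique stationary distribution, and let $\mu^{(N)}$ be the distribution, on $\{0,1,\dots,N\}$, of the total number of particles under $\bar\mu^{(N)}$. *)

(* Defs.v *)
From HB Require Import structures.
From mathcomp Require Import all_boot all_order all_algebra.
From mathcomp Require Import all_classical all_reals all_analysis.

Set Implicit Arguments.
Unset Strict Implicit.
Unset Printing Implicit Defensive.

Import Order.TTheory GRing.Theory Num.Theory.
Import numFieldNormedType.Exports.

Local Open Scope classical_set_scope.
Local Open Scope ring_scope.

(* Vertices of the complete graph on N + 1 vertices: [Some x] with [x : 'I_N]
   is an interior vertex, [None] is the boundary. *)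
Notation vertex N := (option 'I_N).

(* The content of an interior vertex. Particles are indistinguishable; a
   sleeping particle is always alone on its vertex, so a vertex hosts either
   one sleeping particle or k >= 0 active ones ([Active 0] is the empty
   vertex). *)
Notation site := (option nat).
Notation Sleeping := (@None nat).
Notation Active := (@Some nat).

Notation config N := {ffun 'I_N -> site}.

(* The state space {0, s}^N of the driven chain; [true] stands for s. *)
Notation stable N := {ffun 'I_N -> bool}.

Definition config_of_stable (N : nat) (xi : stable N) : config N :=
  [ffun x => if xi x then Sleeping else Active 0%N].

Definition num_particles (N : nat) (xi : stable N) : nat := (\sum_x xi x)%N.

Definition num_active (a : site) : nat := if a is Some k then k else 0%N.

Definition update (N : nat) (eta : config N) (x : 'I_N) (a : site) : config N :=
  [ffun z => if z == x then a else eta z].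

(* An arriving active particle wakes up the sleeping one, if any. *)
Definition arrive (a : site) : site :=
  if a is Some k then Active k.+1 else Active 2%N.

Definition depart (a : site) : site :=
  if a is Some k then Active k.-1 else Sleeping.

Definition add_active (N : nat) (eta : config N) (v : vertex N) : config N :=
  if v is Some y then update eta y (arrive (eta y)) else eta.

Definition jump (N : nat) (eta : config N) (x : 'I_N) (v : vertex N) :
    config N :=
  add_active (update eta x (depart (eta x))) v.

Section ARW.
Variables (R : realType) (lambda : R) (N : nat).

(* Infinitesimal generator of the continuous-time dynamics. Each of the active
   particles at x jumps at rate 1 to a uniform neighbour, i.e. to one of the N
   vertices different from x. Each also has a clock of rate lambda, whose
   rings have an effect only if the particle is the sole active one at x. *)
Definition generator (f : config N -> R) : config N -> R := fun eta =>
  \sum_(x : 'I_N)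
    ((num_active (eta x))%:R *
       (\sum_(v : vertex N | v != Some x) N%:R^-1 * (f (jump eta x v) - f eta))
     + (if eta x == Active 1%N then lambda * (f (update eta x Sleeping) - f eta)
        else 0)).

(* The semigroup e^(tL) of the generator L: [semigroup t f eta] is the
   expectation of f at time t for the dynamics started from eta. No truncation
   of the configuration space is needed: the number of particles never
   increases, so only finitely many configurations are reachable from eta. *)
Definition semigroup (t : R) (f : config N -> R) : config N -> R := fun eta =>
  limn (series (fun n => exp_coeff t n * iter n generator f eta)).

(* Probability that the dynamics started from eta ends in xi. Stable
   configurations are absorbing, so this is the limit, as t tends to infinity,
   of the probability of being in xi at time t. *)
Definition stabilization (eta : config N) (xi : stable N) : R :=
  lim (semigroup t (fun zeta => (zeta == config_of_stable xi)%:R) eta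
         @[t --> +oo]).

Definition driven_kernel (xi xi' : stable N) : R :=
  \sum_(x : 'I_N)
    N%:R^-1 * stabilization (add_active (config_of_stable xi) (Some x)) xi'.

Definition is_stationary (mubar : stable N -> R) : Prop :=
  [/\ forall xi, 0 <= mubar xi,
      \sum_xi mubar xi = 1 &
      forall xi', \sum_xi mubar xi * driven_kernel xi xi' = mubar xi'].

End ARW.

Definition particle_law (R : realType) (N : nat) (mubar : stable N -> R)
    (n : 'I_N.+1) : R :=
  \sum_(xi | num_particles xi == n) mubar xi.

Definition mass_itv (R : realType) (N : nat) (mu : 'I_N.+1 -> R) (a b : R) : R :=
  \sum_(n : 'I_N.+1 | a <= n%:R <= b) mu n.

(* Main.v *)
(** Let S be the number of sleeping particles, B the number of vertices hosting
    active ones, rho = lambda / (1 + lambda) and Z = S + rho B - rho N. An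
    active particle landing on a uniform vertex y changes Z by minus the
    contribution of y to Z, and a lone particle loses rho by leaving and gains
    1 - rho by sleeping, with rates 1 and lambda. So each active particle
    contributes a drift - Z / N to Z, and adding a particle to a stable
    configuration changes Z by - Z / N on average: Z behaves like an
    Ornstein-Uhlenbeck process with bounded jumps in every regime. With theta of
    order 1 / N, exp (theta Z^2) therefore increases by at most C theta per unit
    time and active particle, and under driving its mean decreases by a factor
    1 - theta up to an error C theta. The number of particles decreases at rate
    1 / N per active particle, so exp (theta Z^2) + theta C N (number of
    particles) is superharmonic. Integrating this against the stationary
    distribution gives E exp (theta Z^2) <= C (N + 1), where
    Z = (number of particles) - rho N on stable configurations; Markov's
    inequality with Z^2 of order N log N concludes. *)

Require Import Defs.
From HB Require Import structures.
From mathcomp Require Import all_boot all_order all_algebra.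
From mathcomp Require Import all_classical all_reals all_analysis.
From mathcomp Require Import ring lra.

Import Order.TTheory GRing.Theory Num.Theory.
Import numFieldNormedType.Exports.

Local Open Scope classical_set_scope.
Local Open Scope ring_scope.

Set Implicit Arguments.
Unset Strict Implicit.
Unset Printing Implicit Defensive.

(** * Convergence of the Euler scheme to the exponential series *)

(** The ratio gains one factor [(m - n) / m], at least [1 - n / m], at each step, so the total loss
    is at most the sum of the [i / m] with [i < n]. *)
Lemma ffact_ratio (R : realType) (m n : nat) : (0 < m)%N ->
  1 - n%:R ^+ 2 / m%:R <= ((m ^_ n)%:R / m%:R ^+ n : R) <= 1.
Proof.
move=> m_gt0; have m_gt0' : (0 : R) < m%:R by rewrite ltr0n.
elim: n => [|n /andP[lb ub]]; first by rewrite expr0n mul0r subr0 ffactn0 divr1 lexx.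
rewrite ffactnSr natrM [m%:R ^+ _]exprSr invfM mulrACA.
set r := _ / _ ^+ n in lb ub *.
have r_ge0 : 0 <= r by rewrite divr_ge0 ?exprn_ge0 ?ler0n.
have q_ge0 : (0 : R) <= (m - n)%:R / m%:R by rewrite divr_ge0 ?ler0n.
have q_le1 : (m - n)%:R / m%:R <= 1 :> R.
  by rewrite ler_pdivrMr // mul1r ler_nat leq_subr.
have q_ge : 1 - n%:R / m%:R <= (m - n)%:R / m%:R :> R.
  by rewrite lerBlDr -mulrDl ler_pdivlMr // mul1r -natrD ler_nat addnC -leq_subLR.
have nm_ge0 : (0 : R) <= n%:R / m%:R by rewrite divr_ge0 ?ler0n.
have -> : n.+1%:R ^+ 2 / m%:R
          = n%:R ^+ 2 / m%:R + n%:R / m%:R + n.+1%:R / m%:R :> R.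
  by rewrite -!mulrDl -natr1; congr (_ / _); ring.
have : (0 : R) <= n.+1%:R / m%:R by rewrite divr_ge0 ?ler0n.
by move=> ?; apply/andP; split; nra.
Qed.

(** Each binomial term is the matching exponential term times the ratio of [ffact_ratio], so the
    error is at most [1 / m.+1] times the sum of [n ^ 2 * |b n|], which is finite because [a] grows
    at most geometrically. *)
Lemma euler_series_cvg (R : realType) (t q C : R) (a : nat -> R) :
  0 <= t -> 0 <= q -> (forall n, `|a n| <= C * q ^+ n) ->
  (fun m => \sum_(n < m.+2) 'C(m.+1, n)%:R * (t / m.+1%:R) ^+ n * a n)
    @ \oo --> limn (series (fun n => exp_coeff t n * a n)).
Proof.
move=> t_ge0 q_ge0 a_le.
have C_ge0 : 0 <= C by have := a_le 0%N; rewrite expr0 mulr1; exact: le_trans.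
set b := fun n => exp_coeff t n * a n.
have exp_ge0 n : 0 <= exp_coeff t n by rewrite exp_coeff_ge0.
(* Since [n ^ 2 <= 4 ^ n], the factor [n ^ 2] is absorbed by enlarging the argument of the
   exponential series. *)
have b_le n : n%:R ^+ 2 * `|b n| <= C * exp_coeff (4 * (q * t)) n.
  have -> : exp_coeff (4 * (q * t)) n = 4 ^+ n * (q ^+ n * exp_coeff t n).
    by rewrite /exp_coeff /= !exprMn !mulrA.
  rewrite /b normrM (ger0_norm (exp_ge0 n)) [X in _ <= X]mulrCA.
  rewrite ler_pM ?mulr_ge0 ?exprn_ge0 ?ler0n //.
    have : (n ^ 2 <= 4 ^ n)%N.
      by rewrite -[4%N]/(2 ^ 2)%N -expnM mulnC expnM leq_exp2r // ltnW // ltn_expl.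
    by rewrite -(ler_nat R) !natrX.
  by rewrite mulrA mulrC ler_wpM2r.
have b_cvg : cvgn (series b).
  apply: normed_cvg.
  apply: (@series_le_cvg _ _ (fun n => C * exp_coeff (q * t) n)) => [n|n|n|].
  - exact: normr_ge0.
  - by rewrite mulr_ge0 ?exp_coeff_ge0 ?mulr_ge0.
  - rewrite /= /b normrM (ger0_norm (exp_ge0 n)).
    apply: le_trans (ler_wpM2l (exp_ge0 n) (a_le n)) _.
    by rewrite /exp_coeff /= exprMn le_eqVlt; apply/orP; left; apply/eqP; ring.
  - by apply: is_cvg_seriesZ; exact: is_cvg_series_exp_coeff.
rewrite -[X in _ --> X]addr0.
have E_eq : (fun m => \sum_(n < m.+2) 'C(m.+1, n)%:R * (t / m.+1%:R) ^+ n * a n) =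
    (fun m => series b m.+2 + \sum_(n < m.+2)
       ((m.+1 ^_ n)%:R / m.+1%:R ^+ n - 1) * b n).
  apply/funext => m; rewrite /series /= big_mkord -big_split /=.
  apply: eq_bigr => n _; rewrite mulrBl mul1r addrC subrK.
  rewrite -bin_ffact natrM exprMn exprVn /b /exp_coeff /=.
  have fn0 : (n`!)%:R != 0 :> R by rewrite pnatr_eq0 -lt0n fact_gt0.
  have mn0 : m.+1%:R != 0 :> R by rewrite pnatr_eq0.
  by field; rewrite fn0 expf_neq0.
rewrite E_eq; apply: cvgD.
  have -> : (fun m => series b m.+2) = [sequence series b (m + 2)%N]_m.
    by apply/funext => m /=; rewrite addn2.
  by rewrite cvg_shiftn.
apply/norm_cvg0P.
apply: (@squeeze_cvgr _ _ _ _ (fun=> 0) (fun m => C * expR (4 * (q * t)) * m.+1%:R^-1)).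
- near=> m; rewrite normr_ge0 /=.
  apply: le_trans (ler_norm_sum _ _ _) _.
  apply: (@le_trans _ _ (\sum_(n < m.+2) m.+1%:R^-1 * (C * exp_coeff (4 * (q * t)) n))).
    apply: ler_sum => n _; rewrite normrM.
    have := @ffact_ratio R m.+1 n isT.
    set x := n%:R ^+ 2 / _; set r := _ / _ ^+ n => /andP[lb ub].
    have x_ge0 : 0 <= x by rewrite divr_ge0 ?exprn_ge0 ?ler0n.
    apply: (@le_trans _ _ (x * `|b n|)).
      by rewrite ler_wpM2r // ler_norml; clearbody r x; apply/andP; split; lra.
    by rewrite mulrAC [X in X <= _]mulrC ler_wpM2l ?invr_ge0 ?ler0n ?b_le.
  rewrite -mulr_sumr -mulr_sumr mulrC ler_wpM2r ?invr_ge0 ?ler0n // ler_wpM2l //.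
  rewrite -(big_mkord xpredT (exp_coeff (4 * (q * t)))).
  apply: (@nondecreasing_cvgn_le _ (series (exp_coeff (4 * (q * t))))); last first.
    exact: is_cvg_series_exp_coeff.
  apply: nondecreasing_series => k _ _; rewrite exp_coeff_ge0 ?mulr_ge0 //.
- exact: cvg_cst.
- rewrite -[X in _ --> X](mulr0 (C * expR (4 * (q * t)))).
  by apply: cvgMr; exact: cvg_harmonic.
Unshelve. all: by end_near. Qed.

(** * Linear operators, the Euler scheme and positivity *)

Definition linear_operator (R : realType) (X : Type) (L : (X -> R) -> X -> R) :=
  forall (a : R) (f g : X -> R),
    L (fun y => a * f y + g y) = (fun x => a * L f x + L g x).

(* On [G], [L] is a matrix with nonnegative off-diagonal entries, with diagonal
   entries at least [- q], and with no entry leading out of [G]. *)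
Definition jump_operator_on (R : realType) (X : Type) (G : X -> Prop) (q : R)
    (L : (X -> R) -> X -> R) :=
  forall f x, G x -> (forall y, G y -> 0 <= f y) -> 0 <= L f x + q * f x.

Definition euler_step (R : realType) (X : Type) (s : R)
    (L : (X -> R) -> X -> R) (f : X -> R) : X -> R :=
  fun x => s * L f x + f x.

Lemma iter_linear_operator (R : realType) (X : Type)
    (L : (X -> R) -> X -> R) (n : nat) :
  linear_operator L -> linear_operator (iter n L).
Proof. by move=> Llin a f g; elim: n => //= n ->; rewrite Llin. Qed.

Lemma euler_step_linear (R : realType) (X : Type) (s : R)
    (L : (X -> R) -> X -> R) :
  linear_operator L -> linear_operator (euler_step s L).
Proof. by move=> Llin a f g; apply/funext => x; rewrite /euler_step Llin; ring. Qed.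

Lemma linear_operator0 (R : realType) (X : Type) (L : (X -> R) -> X -> R) :
  linear_operator L -> L (fun=> 0) = (fun=> 0).
Proof.
move=> Llin; have := Llin (- 1) (fun=> 0) (fun=> 0).
rewrite (_ : (fun y => _) = fun=> 0); last by apply/funext => y; rewrite mulr0 addr0.
by move=> ->; apply/funext => x; rewrite mulN1r addNr.
Qed.

Lemma linear_operatorZ (R : realType) (X : Type) (L : (X -> R) -> X -> R)
    (a : R) (f : X -> R) :
  linear_operator L -> L (fun y => a * f y) = (fun x => a * L f x).
Proof.
move=> Llin; have := Llin a f (fun=> 0); rewrite (linear_operator0 Llin).
rewrite (_ : (fun y => _) = fun y => a * f y); last by apply/funext => y; rewrite addr0.
by move=> ->; apply/funext => x; rewrite addr0.
Qed.

Lemma linear_operator_sum (R : realType) (X : Type) (I : finType)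
    (L : (X -> R) -> X -> R) (c : I -> R) (f : I -> X -> R) (x : X) :
  linear_operator L ->
  L (fun y => \sum_i c i * f i y) x = \sum_i c i * L (f i) x.
Proof.
move=> Llin.
elim: (index_enum I) => [|i r IHr].
  rewrite big_nil -[RHS](congr1 (@^~ x) (linear_operator0 Llin)).
  by congr (L _ x); apply/funext => y; rewrite big_nil.
rewrite big_cons -IHr -[RHS]/((fun x => c i * L (f i) x + _ x) x) -Llin.
by congr (L _ x); apply/funext => y; rewrite big_cons.
Qed.

(** The binomial theorem for [1 + s L], by Pascal's rule. *)
Lemma iter_euler_stepE (R : realType) (X : Type) (s : R)
    (L : (X -> R) -> X -> R) (m : nat) (f : X -> R) (x : X) :
  linear_operator L ->
  iter m (euler_step s L) f x =
    \sum_(n < m.+1) 'C(m, n)%:R * s ^+ n * iter n L f x.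
Proof.
move=> Llin; elim: m f => [|m IHm] f.
  by rewrite big_ord1 bin0 expr0 !mul1r.
rewrite iterSr IHm [RHS]big_ord_recl /= bin0 expr0 !mul1r.
under [in RHS]eq_bigr => i _.
  rewrite /bump /= add1n binS natrD !mulrDl.
  over.
rewrite big_split /= addrA.
have -> : f x + \sum_(i < m.+1) 'C(m, i.+1)%:R * s ^+ i.+1 * L (iter i L f) x
    = \sum_(i < m.+1) 'C(m, i)%:R * s ^+ i * iter i L f x.
  rewrite big_ord_recr /= bin_small // !mul0r addr0.
  by rewrite [RHS]big_ord_recl /= bin0 expr0 !mul1r.
rewrite -big_split /=; apply: eq_bigr => i _.
rewrite [iter i L _ _](congr1 (@^~ x) (iter_linear_operator i Llin s (L f) f)).
by rewrite -iterSr iterS exprSr; ring.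
Qed.

(** If [|g| <= B] on [G], then [B - g] and [B + g] are nonnegative there; as [L] kills constants,
    positivity gives [|L g| <= 2 q B] on [G]. *)
Lemma iter_jump_operator_bounded (R : realType) (X : Type) (G : X -> Prop)
    (q C : R) (L : (X -> R) -> X -> R) (f : X -> R) (n : nat) (x : X) :
  linear_operator L -> L (fun=> 1) = (fun=> 0) ->
  jump_operator_on G q L ->
  (forall y, G y -> `|f y| <= C) -> G x ->
  `|iter n L f x| <= C * (2 * q) ^+ n.
Proof.
move=> Llin L1 Ljump f_le; elim: n x => [|n IHn] x Gx.
  by rewrite expr0 mulr1 f_le.
set g := iter n L f in IHn *; set B := C * _ ^+ n in IHn.
(* [e] is a sign, so that both bounds on [L g x] come from one argument. *)
have side (e : R) : e ^+ 2 = 1 -> e * L g x <= q * (B - e * g x).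
  move=> e2.
  have := Ljump (fun y => B * 1 + (- e) * g y) x Gx.
  rewrite Llin (linear_operatorZ _ _ Llin) L1 => H.
  suff /H : forall y, G y -> 0 <= B * 1 + (- e) * g y by lra.
  move=> y /IHn; rewrite ler_norml => /andP[? ?].
  have /orP[/eqP -> | /eqP ->] : (e == 1) || (e == -1) by rewrite -sqrf_eq1 e2.
    by lra.
  by lra.
have := side 1; have := side (- 1); rewrite sqrrN expr1n => /(_ erefl) h1 /(_ erefl) h2.
rewrite /= -/g ler_norml exprSr mulrA -/B.
have := IHn _ Gx; rewrite ler_norml => /andP[? ?].
have q_ge0 : 0 <= q by have := Ljump _ x Gx (fun _ _ => ler01); rewrite L1 add0r mulr1.
by apply/andP; split; nra.
Qed.

(** For [s q <= 1] the operator [1 + s L] is monotone on [G], and it does not increase the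
    superharmonic [h]. *)
Lemma iter_euler_step_le (R : realType) (X : Type) (G : X -> Prop) (q s : R)
    (L : (X -> R) -> X -> R) (f h : X -> R) (m : nat) (x : X) :
  linear_operator L -> jump_operator_on G q L ->
  0 <= s -> s * q <= 1 ->
  (forall y, G y -> f y <= h y) -> (forall y, G y -> L h y <= 0) ->
  G x -> iter m (euler_step s L) f x <= h x.
Proof.
move=> Llin Ljump s_ge0 sq_le1 fh Lh; elim: m x => [|m IHm] x Gx; first exact: fh.
rewrite iterS; set g := iter m _ f in IHm *.
have := Ljump (fun y => (- 1) * g y + h y) x Gx; rewrite Llin => H.
have {}H : 0 <= - 1 * L g x + L h x + q * (- 1 * g x + h x).
  by apply: H => y /IHm; rewrite mulN1r addrC subr_ge0.
have := Lh x Gx; have := IHm x Gx; rewrite /euler_step; nra.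
Qed.

(* Positivity of the semigroup is read off the Euler scheme (1 + (t/m) L)^m,
   which is positive once q t <= m and converges to the exponential series. *)
Lemma semigroup_sum_le (R : realType) (X : Type) (G : X -> Prop) (q t : R)
    (L : (X -> R) -> X -> R) (I : finType) (c : I -> R) (f : I -> X -> R)
    (h : X -> R) (x : X) :
  linear_operator L -> L (fun=> 1) = (fun=> 0) ->
  jump_operator_on G q L -> 0 <= t ->
  (forall i, exists C, forall y, G y -> `|f i y| <= C) ->
  (forall y, G y -> \sum_i c i * f i y <= h y) ->
  (forall y, G y -> L h y <= 0) -> G x ->
  \sum_i c i * limn (series (fun n => exp_coeff t n * iter n L (f i) x)) <= h x.
Proof.
move=> Llin L1 Ljump t_ge0 f_bdd fh Lh Gx.
have q_ge0 : 0 <= q by have := Ljump _ x Gx (fun _ _ => ler01); rewrite L1 add0r mulr1.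
pose E m g := iter m.+1 (euler_step (t / m.+1%:R) L) g x.
have E_cvg i : (E^~ (f i)) @ \oo -->
    limn (series (fun n => exp_coeff t n * iter n L (f i) x)).
  have [C C_le] := f_bdd i.
  have := @euler_series_cvg R t (2 * q) C (fun n => iter n L (f i) x) t_ge0.
  rewrite mulr_ge0 // => /(_ isT (fun n => _)).
  under eq_fun do rewrite -(iter_euler_stepE _ _ _ _ Llin).
  by apply => n; exact: (iter_jump_operator_bounded (G := G)).
have S_cvg : (fun m => \sum_i c i * E m (f i)) @ \oo -->
    \sum_i c i * limn (series (fun n => exp_coeff t n * iter n L (f i) x)).
  by apply: cvg_big => // [|i _]; [exact: add_continuous|exact: cvgMr].
rewrite -(cvg_lim _ S_cvg) //; apply: limr_le; first by apply/cvg_ex; eexists; exact: S_cvg.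
have /cvgr_dist_le/(_ 1 ltr01) : (fun m => t * q * m.+1%:R^-1) @ \oo --> (0 : R).
  by rewrite -[X in _ --> X](mulr0 (t * q)); apply: cvgMr; exact: cvg_harmonic.
apply: filterS => m; rewrite sub0r normrN ger0_norm ?mulr_ge0 // => m_large.
rewrite /E -(linear_operator_sum (L := iter m.+1 _)); last first.
  by apply: iter_linear_operator; exact: euler_step_linear.
by apply: (iter_euler_step_le (G := G) (q := q)) => //; [rewrite divr_ge0|rewrite mulrAC].
Qed.

(** * Additive functionals of a configuration and their increments *)

Lemma sum_option (R : realType) (T : finType) (F : option T -> R) :
  \sum_v F v = F None + \sum_y F (Some y).
Proof.
rewrite (bigD1 None) //=; congr (_ + _).
rewrite (reindex_omap Some id) => [|[]//].
by apply: eq_bigl => y; rewrite /= eqxx.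
Qed.

Lemma sum_neighbour (R : realType) (N : nat) (x : 'I_N) (F : vertex N -> R) :
  \sum_(v | v != Some x) F v = F None + \sum_y F (Some y) - F (Some x).
Proof. by rewrite -sum_option [X in _ = X - _](bigD1 (Some x)) //= addrAC subrr add0r. Qed.

Lemma sum_neighbour_cst (R : realType) (N : nat) (x : 'I_N) (a : R) :
  \sum_(v : vertex N | v != Some x) N%:R^-1 * a = a.
Proof.
rewrite sum_neighbour sumr_const card_ord addrC addKr -[LHS]mulr_natl mulrA divff ?mul1r //.
by rewrite pnatr_eq0 -lt0n (leq_ltn_trans _ (ltn_ord x)).
Qed.

Definition config_sum (R : realType) (N : nat) (F : site -> R) (eta : config N) : R :=
  \sum_x F (eta x).

Definition site_size (R : realType) (a : site) : R := if a is Some k then k%:R else 1.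

(* Summed over the vertices this is S + rho B - rho N, for S sleeping particles
   and B vertices hosting active ones: a lone active particle falls asleep
   before jumping with probability rho = lambda / (1 + lambda). *)
Definition site_excess (R : realType) (rho : R) (a : site) : R :=
  match a with None => 1 - rho | Some 0%N => - rho | Some _.+1 => 0 end.

Lemma config_sum_update (R : realType) (N : nat) (F : site -> R) (eta : config N) x a :
  config_sum F (update eta x a) = config_sum F eta - F (eta x) + F a.
Proof.
rewrite /config_sum !(bigD1 x (P := xpredT)) //= ffunE eqxx.
rewrite (eq_bigr (fun y => F (eta y))); first by ring.
by move=> y /negbTE yx; rewrite ffunE yx.
Qed.

Lemma config_sum_jump (R : realType) (N : nat) (F : site -> R) (eta : config N) x v :
  v != Some x ->
  config_sum F (jump eta x v) = config_sum F eta - F (eta x) + F (depart (eta x))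
    + (if v is Some y then F (arrive (eta y)) - F (eta y) else 0).
Proof.
case: v => [y|] yx; rewrite /jump /= ?config_sum_update ?addr0 //.
rewrite {1 2}/update !ffunE; have -> : y == x = false.
  by apply: contraNF yx => /eqP ->.
by ring.
Qed.

Lemma site_excess_arrive (R : realType) (rho : R) (a : site) :
  site_excess rho (arrive a) = 0.
Proof. by case: a. Qed.

Lemma site_size_arrive (R : realType) (a : site) :
  site_size R (arrive a) = site_size R a + 1.
Proof. by case: a => [k|] /=; rewrite ?natr1. Qed.

Lemma site_size_depart (R : realType) (a : site) : (0 < num_active a)%N ->
  site_size R (depart a) = site_size R a - 1.
Proof. by case: a => [[//|k]|//] _ /=; rewrite -natr1 addrK. Qed.

Lemma size_jump (R : realType) (N : nat) (eta : config N) x v :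
  v != Some x -> (0 < num_active (eta x))%N ->
  config_sum (site_size R) (jump eta x v) =
    config_sum (site_size R) eta - (v == None)%:R.
Proof.
move=> vx kx; rewrite config_sum_jump // site_size_depart //.
by case: v {vx} => [y|]; rewrite ?site_size_arrive /=; ring.
Qed.

(** An arrival always leaves a site of excess 0, hence subtracts the old excess of the target; a
    departure matters only when it empties the site. *)
Lemma excess_jump (R : realType) (rho : R) (N : nat) (eta : config N) x v :
  v != Some x -> (0 < num_active (eta x))%N ->
  config_sum (site_excess rho) (jump eta x v) =
    config_sum (site_excess rho) eta
    + (- ((eta x == Active 1)%:R * rho)
       - (if v is Some y then site_excess rho (eta y) else 0)).
Proof.
move=> vx kx; rewrite config_sum_jump //.
have -> : site_excess rho (depart (eta x)) =
    site_excess rho (eta x) - (eta x == Active 1)%:R * rho.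
  by case: (eta x) kx => [[|[|k]]|] //= _; rewrite ?mul1r ?mul0r ?subr0 ?sub0r.
by case: v {vx} => [y|]; rewrite ?site_excess_arrive; ring.
Qed.

Lemma excess_norm_le (R : realType) (rho : R) (N : nat) (eta : config N) :
  0 <= rho <= 1 -> `|config_sum (site_excess rho) eta| <= N%:R.
Proof.
move=> /andP[? ?]; apply: le_trans (ler_norm_sum _ _ _) _.
rewrite -[N in leRHS]card_ord -sumr_const; apply: ler_sum => x _.
by case: (eta x) => [[|k]|] /=; rewrite ler_norml; apply/andP; split; lra.
Qed.

(** * The generator as a jump operator *)

Lemma generator_linear (R : realType) (lambda : R) (N : nat) :
  linear_operator (@generator R lambda N).
Proof.
move=> a f g; apply/funext => eta; rewrite /generator mulr_sumr -big_split /=.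
apply: eq_bigr => x _.
have -> : \sum_(v : vertex N | v != Some x)
      N%:R^-1 * (a * f (jump eta x v) + g (jump eta x v) - (a * f eta + g eta)) =
    a * (\sum_(v : vertex N | v != Some x) N%:R^-1 * (f (jump eta x v) - f eta))
    + \sum_(v : vertex N | v != Some x) N%:R^-1 * (g (jump eta x v) - g eta).
  by rewrite mulr_sumr -big_split; apply: eq_bigr => v _ /=; ring.
by case: ifP => _; ring.
Qed.

Lemma generator1 (R : realType) (lambda : R) (N : nat) :
  @generator R lambda N (fun=> 1) = (fun=> 0).
Proof.
apply/funext => eta; rewrite /generator big1 // => x _.
rewrite big1 ?mulr0 ?add0r; first by case: ifP; rewrite ?subrr ?mulr0.
by move=> v _; rewrite subrr mulr0.
Qed.

(** No move increases the number of particles, and the exit rate is at most 1 per particle plus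
    [lambda] per vertex. *)
Lemma generator_jump_operator (R : realType) (lambda : R) (N : nat) (K : R) :
  0 <= lambda ->
  jump_operator_on (fun eta : config N => config_sum (site_size R) eta <= K)
    (K + lambda * N%:R) (@generator R lambda N).
Proof.
move=> l_ge0 f eta etaK f_ge0.
have f0 := f_ge0 _ etaK.
apply: (@le_trans _ _ (\sum_(x < N) - (((num_active (eta x))%:R + lambda) * f eta)
    + (K + lambda * N%:R) * f eta)).
  rewrite sumrN -mulr_suml big_split /= sumr_const card_ord -mulr_natr.
  have : \sum_(x < N) (num_active (eta x))%:R <= K.
    apply: le_trans etaK; apply: ler_sum => x _.
    by case: (eta x) => [k|] /=; rewrite ?ler01.
  by nra.
rewrite lerD2r; apply: ler_sum => x _; rewrite mulrDl opprD lerD //.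
  have [->|k_gt0] := posnP (num_active (eta x)); first by rewrite !mul0r oppr0.
  rewrite -mulrN ler_wpM2l ?ler0n // -[leLHS](@sum_neighbour_cst R N x).
  apply: ler_sum => v vx; rewrite ler_wpM2l ?invr_ge0 ?ler0n // lerDr f_ge0 //.
  rewrite size_jump //; apply: le_trans etaK; rewrite gerDl oppr_le0 ler0n //.
case: ifP => [/eqP etax|_]; last by rewrite oppr_le0 mulr_ge0.
rewrite -mulrN ler_wpM2l // lerDr f_ge0 // config_sum_update etax /=.
by rewrite subrK.
Qed.

(** * Increments of the exponential of a square *)

(** [expR u * (1 - u) <= 1], while [(1 + u + 2 u^2) (1 - u) = 1 + u^2 (1 - 2 u) >= 1]. *)
Lemma expR_quadratic_le (R : realType) (u : R) : u <= 2^-1 ->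
  expR u <= 1 + u + 2 * u ^+ 2.
Proof.
move=> u_le; have e_gt0 := expR_gt0 u; have := expR_ge1Dx (- u).
have : expR u * expR (- u) = 1 by rewrite expRN divff ?lt0r_neq0.
set a := expR u in e_gt0 *; set b := expR (- u) => ab b_ge.
have : a * (1 - u) <= 1 by nra.
nra.
Qed.

(** The term linear in [d] is kept exact, because its average is the drift; [theta * d ^+ 2] and the
    quadratic remainder go into the error. *)
Lemma exp_square_increment_le (R : realType) (theta z d M : R) :
  0 <= theta -> theta * (2 * M + 1) <= 4^-1 -> `|z| <= M -> `|d| <= 1 ->
  expR (theta * (z + d) ^+ 2) - expR (theta * z ^+ 2) <=
    expR (theta * z ^+ 2) * (2 * theta * z * d + (2 * theta + 16 * theta ^+ 2 * z ^+ 2)).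
Proof.
move=> th_ge0 thM zM d1.
have M_ge0 : 0 <= M by exact: le_trans zM.
pose u := theta * (2 * z * d + d ^+ 2).
have -> : theta * (z + d) ^+ 2 = theta * z ^+ 2 + u by rewrite /u; ring.
rewrite expRD -[X in _ - X]mulr1 -mulrBr ler_wpM2l ?expR_ge0 //.
have d2 : d ^+ 2 <= 1 by rewrite -real_normK ?num_real // exprn_ile1.
have u_abs : `|2 * z * d + d ^+ 2| <= 2 * `|z| + 1.
  apply: le_trans (ler_normD _ _) _; rewrite !normrM (ger0_norm (x := 2)) // lerD //.
    by rewrite ler_piMr // mulr_ge0.
  by rewrite mulr_ile1.
have u_le : u <= 2^-1.
  have := ler_norm (2 * z * d + d ^+ 2); rewrite /u; nra.
have := expR_quadratic_le u_le.
have : u ^+ 2 <= theta ^+ 2 * (8 * z ^+ 2 + 2).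
  rewrite /u exprMn ler_wpM2l ?sqr_ge0 //.
  have := sqr_ge0 (2 * z * d - d ^+ 2); nra.
have thM_ge0 : 0 <= theta * M by rewrite mulr_ge0.
have th_le : theta <= 4^-1 by move: thM; rewrite mulrDr mulr1; lra.
have : 4 * theta ^+ 2 <= theta by rewrite expr2 mulrA ler_piMl //; lra.
have : theta * d ^+ 2 <= theta by rewrite ler_piMr.
have : u = 2 * theta * z * d + theta * d ^+ 2 by rewrite /u; ring.
lra.
Qed.

(** * Superharmonic functions under stabilization and stationarity *)

Lemma config_of_stable_inj (N : nat) : injective (@config_of_stable N).
Proof.
move=> xi xi' /ffunP e; apply/ffunP => x; have := e x; rewrite !ffunE.
by case: (xi x); case: (xi' x).
Qed.

Lemma site_size_ge0 (R : realType) (N : nat) (eta : config N) :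
  0 <= config_sum (site_size R) eta.
Proof. by apply: sumr_ge0 => x _; case: (eta x) => //= k; rewrite ler0n. Qed.

(** The function equal to [h] on stable configurations and 0 elsewhere lies below [h]; its mean at
    each time is thus at most [h eta], and time tends to infinity. *)
Lemma stabilization_sum_le (R : realType) (lambda : R) (N : nat)
    (h : config N -> R) (eta : config N) :
  0 <= lambda -> (forall zeta, 0 <= h zeta) ->
  (forall zeta, generator lambda h zeta <= 0) ->
  \sum_xi h (config_of_stable xi) * stabilization lambda eta xi <= h eta.
Proof.
move=> l_ge0 h_ge0 Lh.
pose f (xi : stable N) (zeta : config N) : R := (zeta == config_of_stable xi)%:R.
pose S xi t := semigroup lambda t (f xi) eta.
have f_bdd xi zeta : `|f xi zeta| <= 1.
  by rewrite /f; case: eqP; rewrite ?normr1 ?normr0 ?ler01.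
have jump := @generator_jump_operator R lambda N (config_sum (site_size R) eta) l_ge0.
have L1 := generator1 lambda N; have Llin := @generator_linear R lambda N.
have S_sum_le (t : R) : 0 <= t ->
    \sum_xi h (config_of_stable xi) * S xi t <= h eta.
  move=> t_ge0; apply: (semigroup_sum_le Llin L1 jump t_ge0) => //.
    by move=> xi; exists 1 => zeta _; exact: f_bdd.
  move=> zeta _; have [[xi0 zE]|no] := pselect (exists xi, zeta = config_of_stable xi).
    rewrite (bigD1 xi0) //= big1 ?addr0; first by rewrite /f zE eqxx mulr1.
    move=> xi ne; rewrite /f zE (inj_eq (@config_of_stable_inj N)) eq_sym.
    by rewrite (negbTE ne) mulr0.
  rewrite big1 // => xi _; rewrite /f; case: eqP => [e|_]; last by rewrite mulr0.
  by case: no; exists xi.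
(* Positivity is the same comparison for a one-element family, with coefficient [-1] and bound 0. *)
have S_ge0 xi (t : R) : 0 <= t -> 0 <= S xi t.
  move=> t_ge0; rewrite -oppr_le0.
  have := semigroup_sum_le (I := unit) (c := fun=> -1) (f := fun=> f xi) (h := fun=> 0)
    Llin L1 jump t_ge0.
  move=> /(_ eta); rewrite (big_pred1 tt) ?mulN1r; last by case.
  apply => //.
  - by move=> _; exists 1 => zeta _; exact: f_bdd.
  - by move=> zeta _; rewrite (big_pred1 tt) ?mulN1r ?oppr_le0 ?ler0n //; case.
  - by move=> zeta _; rewrite (linear_operator0 Llin).
(* A limit that does not exist would have the junk value 0, so the limits need
   not be shown to exist. *)
pose g xi t := if pselect (cvg (S xi t @[t --> +oo])) is left _ then S xi t else 0.
have g_cvg xi : g xi t @[t --> +oo] --> stabilization lambda eta xi.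
  rewrite /g; case: pselect => [//|dvg].
  by rewrite /stabilization (dvgP dvg); exact: cvg_cst.
have sum_cvg : \sum_xi h (config_of_stable xi) * g xi t @[t --> +oo] -->
    \sum_xi h (config_of_stable xi) * stabilization lambda eta xi.
  by apply: cvg_big => // [|xi _]; [exact: add_continuous|exact: cvgMr].
rewrite -(cvg_lim _ sum_cvg) //; apply: limr_le.
  by apply/cvg_ex; eexists; exact: sum_cvg.
near=> t; have t_ge0 : 0 <= t by near: t; exact: nbhs_pinfty_ge.
apply: le_trans (S_sum_le t t_ge0); apply: ler_sum => xi _; rewrite ler_wpM2l //.
by rewrite /g; case: pselect => // _; exact: S_ge0.
Unshelve. all: by end_near. Qed.

(** Stationarity rewrites the left mean as one after a driven step, whose stabilization phase does
    not increase the mean of [h]. *)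
Lemma stationary_sum_le (R : realType) (lambda : R) (N : nat)
    (mu : stable N -> R) (h : config N -> R) :
  0 <= lambda -> is_stationary lambda mu -> (forall zeta, 0 <= h zeta) ->
  (forall zeta, generator lambda h zeta <= 0) ->
  \sum_xi mu xi * h (config_of_stable xi) <=
  \sum_xi mu xi * \sum_x N%:R^-1 * h (add_active (config_of_stable xi) (Some x)).
Proof.
move=> l_ge0 [mu_ge0 _ mu_stat] h_ge0 Lh.
under [leLHS]eq_bigr => xi' _ do rewrite -mu_stat mulr_suml.
rewrite exchange_big; apply: ler_sum => xi _ /=.
under [leLHS]eq_bigr => xi' _ do rewrite -mulrA.
rewrite -mulr_sumr ler_wpM2l // /driven_kernel.
under [leLHS]eq_bigr => xi' _ do rewrite mulr_suml.
rewrite exchange_big; apply: ler_sum => x _ /=.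
under [leLHS]eq_bigr => xi' _ do rewrite -mulrA.
rewrite -mulr_sumr ler_wpM2l ?invr_ge0 ?ler0n //.
under [leLHS]eq_bigr => xi' _ do rewrite mulrC.
exact: stabilization_sum_le.
Qed.

(** * Drift and stationary mean of the Gaussian weight *)

(* The constant makes (1 + lambda) * 16 theta^2 equal to theta / N, so that half
   of the linear drift absorbs the quadratic error. *)
Definition rate_theta (R : realType) (lambda : R) (N : nat) : R :=
  (16 * (1 + lambda) * N%:R)^-1.

(** The constant of [gaussian_confinement] at [c = 2 * (1 + lambda)]. *)
Definition drift_bound (R : realType) (lambda : R) : R :=
  (2 * (1 + lambda) + 1) * expR (2 * (1 + lambda) + 1).

Definition gaussian_weight (R : realType) (lambda : R) (N : nat) (eta : config N) : R :=
  expR (rate_theta lambda N *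
        config_sum (site_excess (lambda / (1 + lambda))) eta ^+ 2).

(** If [z ^+ 2 / M >= c + 1], the bracket is at most [-1]; otherwise [theta * z ^+ 2 <= c + 1]
    bounds the exponential. *)
Lemma gaussian_confinement (R : realType) (theta c z M : R) :
  0 <= theta -> 0 < M -> theta * M <= 1 -> 0 <= c ->
  expR (theta * z ^+ 2) * (c - z ^+ 2 / M) <=
    (c + 1) * expR (c + 1) - expR (theta * z ^+ 2).
Proof.
move=> th_ge0 M_gt0 thM c_ge0.
set y := z ^+ 2 / M.
have zE : z ^+ 2 = y * M by rewrite /y divfK ?lt0r_neq0.
have y_ge0 : 0 <= y by rewrite divr_ge0 ?sqr_ge0 // ltW.
have w_gt0 := expR_gt0 (theta * z ^+ 2); set w := expR (theta * _) in w_gt0 *.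
have e_gt0 := expR_gt0 (c + 1).
have [y_ge|y_lt] := leP (c + 1) y; first by nra.
have : w <= expR (c + 1).
  by rewrite ler_expR zE mulrCA; apply: le_trans (ltW y_lt); rewrite ler_piMr.
nra.
Qed.

Section Drift.
Variables (R : realType) (lambda : R) (N : nat).
Hypothesis (lambda_gt0 : 0 < lambda) (N_gt0 : (0 < N)%N).

Local Notation rho := (lambda / (1 + lambda)).
Local Notation theta := (rate_theta lambda N).
Local Notation C := (drift_bound lambda).
Local Notation Z := (config_sum (site_excess rho)).
Local Notation size := (config_sum (site_size R)).
Local Notation W := (@gaussian_weight R lambda N).

Let N_gt0' : 0 < N%:R :> R. Proof. by rewrite ltr0n. Qed.
Let N_ge1 : 1 <= N%:R :> R. Proof. by rewrite ler1n. Qed.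
Let lambda1_gt0 : 0 < 1 + lambda. Proof. by rewrite addr_gt0. Qed.

Lemma rate_theta_gt0 : 0 < theta.
Proof. by rewrite invr_gt0 !mulr_gt0. Qed.

Lemma rate_thetaE : 16 * (1 + lambda) * (theta * N%:R) = 1.
Proof. by rewrite mulrCA mulVf // lt0r_neq0 // !mulr_gt0. Qed.

Lemma rate_theta_le : theta * N%:R <= 16^-1.
Proof.
have := lambda_gt0; have := rate_thetaE.
have : 0 < theta * N%:R by rewrite mulr_gt0 ?rate_theta_gt0.
by nra.
Qed.

Lemma rate_theta_small : theta * (2 * N%:R + 1) <= 4^-1.
Proof.
have := rate_theta_le.
have : theta <= theta * N%:R by rewrite ler_peMr // ltW ?rate_theta_gt0.
by have := lambda1_gt0; lra.
Qed.

Lemma rho_itv : 0 <= rho <= 1.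
Proof.
apply/andP; split; first by rewrite divr_ge0 // ltW.
by rewrite ler_pdivrMr // mul1r lerDr.
Qed.

Lemma gaussian_drift (eta : config N) :
  W eta * (2 * theta * Z eta * (- Z eta / N%:R)
    + (1 + lambda) * (2 * theta + 16 * theta ^+ 2 * Z eta ^+ 2)) <=
  theta * (C - W eta).
Proof.
rewrite /gaussian_weight; set z := Z eta.
have -> : 2 * theta * z * (- z / N%:R)
    + (1 + lambda) * (2 * theta + 16 * theta ^+ 2 * z ^+ 2)
    = theta * (2 * (1 + lambda) - z ^+ 2 / N%:R).
  have : 16 * (1 + lambda) * theta = N%:R^-1.
    apply: (mulIf (lt0r_neq0 N_gt0')); rewrite mulVf ?lt0r_neq0 //.
    by have := rate_thetaE; rewrite mulrA.
  set i := N%:R^-1; move=> e.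
  have -> : z ^+ 2 / N%:R = z ^+ 2 * (16 * (1 + lambda) * theta) by rewrite e.
  by rewrite mulNr -/i -e; ring.
rewrite mulrCA ler_wpM2l ?(ltW rate_theta_gt0) //.
apply: gaussian_confinement => //; first by rewrite ltW ?rate_theta_gt0.
  by have := rate_theta_le; lra.
by have := lambda1_gt0; lra.
Qed.

Lemma gaussian_weight_increment (eta zeta : config N) (d : R) :
  Z zeta = Z eta + d -> `|d| <= 1 ->
  W zeta - W eta <= W eta * (2 * theta * Z eta * d
    + (2 * theta + 16 * theta ^+ 2 * Z eta ^+ 2)).
Proof.
move=> Zz d1; rewrite /gaussian_weight Zz.
apply: (exp_square_increment_le (M := N%:R)) => //.
- by rewrite ltW ?rate_theta_gt0.
- exact: rate_theta_small.
- by apply: excess_norm_le; exact: rho_itv.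
Qed.

Lemma generator_size (eta : config N) :
  generator lambda size eta = - (\sum_x (num_active (eta x))%:R) / N%:R.
Proof.
rewrite /generator mulNr mulr_suml -[RHS]sumrN; apply: eq_bigr => x _.
have -> : (if eta x == Active 1 then
    lambda * (size (update eta x Sleeping) - size eta) else 0) = 0.
  by case: ifP => // /eqP e; rewrite config_sum_update e /= subrK subrr mulr0.
rewrite addr0; have [->|k_gt0] := posnP (num_active (eta x)); first by rewrite !mul0r oppr0.
rewrite -mulrN; congr (_ * _).
rewrite (eq_bigr (fun v : vertex N => N%:R^-1 * - (v == None)%:R)); last first.
  by move=> v vx; rewrite size_jump // addrAC subrr add0r.
rewrite sum_neighbour /= big1 ?addr0; first by rewrite oppr0 mulr0 subr0 mulrN mulr1.
by move=> y _; rewrite oppr0 mulr0.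
Qed.

(** For a lone particle the jump term [- rho] cancels against the sleeping term
    [lambda * (1 - rho)]; other active particles have neither. Only the drift [- Z / N] remains. *)
Lemma generator_gaussian (eta : config N) :
  generator lambda W eta <= theta * C * \sum_x (num_active (eta x))%:R.
Proof.
rewrite /generator mulr_sumr; apply: ler_sum => x _.
have [k0|k_gt0] := posnP (num_active (eta x)).
  by rewrite k0 mul0r mulr0 add0r; case: ifP => // /eqP e; rewrite e in k0.
set z := Z eta; set e := 2 * theta + 16 * theta ^+ 2 * z ^+ 2.
have e_ge0 : 0 <= e.
  have th_ge0 := ltW rate_theta_gt0; apply: addr_ge0; first exact: mulr_ge0.
  by rewrite -mulrA -exprMn mulr_ge0 // sqr_ge0.
have W_gt0 : 0 < W eta := expR_gt0 _.
have /andP[rho_ge0 rho_le1] := rho_itv.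
set one := (eta x == Active 1)%:R : R.
have rhoE : lambda * (1 - rho) = rho by field; rewrite lt0r_neq0.
have jumps : \sum_(v : vertex N | v != Some x) N%:R^-1 * (W (jump eta x v) - W eta) <=
    W eta * (2 * theta * z * (- (one * rho) - z / N%:R) + e).
  pose d (v : vertex N) : R :=
    - (one * rho) - (if v is Some y then site_excess rho (eta y) else 0).
  apply: (@le_trans _ _ (\sum_(v : vertex N | v != Some x)
      N%:R^-1 * (W eta * (2 * theta * z * d v + e)))).
    apply: ler_sum => v vx; rewrite ler_wpM2l ?invr_ge0 ?ler0n //.
    apply: gaussian_weight_increment; first exact: excess_jump.
    rewrite /d /one; case: v {vx} => [y|]; [case: (eta y) => [[|k]|]|];
      case: eqP => _ /=; rewrite ?mul1r ?mul0r ler_norml; apply/andP; split; lra.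
  rewrite -mulr_sumr -mulr_sumr big_split /= -mulr_sumr.
  (* The omitted vertex [x] hosts active particles, so its excess is 0 and the sum over the others
     is all of [z]. *)
  have -> : \sum_(v : vertex N | v != Some x) d v = N%:R * - (one * rho) - z.
    rewrite big_split /=; congr (_ + _).
      by rewrite sum_neighbour sumr_const card_ord addrAC subrr add0r mulr_natl.
    rewrite sumrN sum_neighbour add0r; congr (- _).
    by case: (eta x) k_gt0 => [[]|] //= k _; rewrite subr0.
  have -> : \sum_(v : vertex N | v != Some x) e = N%:R * e.
    by rewrite sum_neighbour sumr_const card_ord addrAC subrr add0r mulr_natl.
  rewrite mulrCA le_eqVlt; apply/orP; left; apply/eqP; congr (_ * _).
  by field; rewrite !lt0r_neq0.
have falls : (if eta x == Active 1 then lambda * (W (update eta x Sleeping) - W eta) else 0)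
    <= one * (lambda * (W eta * (2 * theta * z * (1 - rho) + e))).
  rewrite /one; case: eqP => [ex|_]; last by rewrite mul0r.
  rewrite mul1r ler_wpM2l ?(ltW lambda_gt0) //; apply: gaussian_weight_increment.
    by rewrite config_sum_update ex /= subr0.
  by rewrite ger0_norm; lra.
apply: le_trans (lerD (ler_wpM2l _ jumps) falls) _; first by rewrite ler0n.
have drift := gaussian_drift eta; rewrite -/z -/e in drift.
set k := (num_active (eta x))%:R : R.
have k_ge1 : 1 <= k by rewrite ler1n.
(* The cancellation needs equal weights on jumps and on falling asleep, which holds since [one = 1]
   forces [k = 1]. *)
have onek : one = 0 \/ one = 1 /\ k = 1.
  by rewrite /one /k; case: eqP => [->|_]; [right|left].
have th_gt0 := rate_theta_gt0.
suff : k * (W eta * (2 * theta * z * (- (one * rho) - z / N%:R) + e)) +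
   one * (lambda * (W eta * (2 * theta * z * (1 - rho) + e))) <=
   k * (W eta * (2 * theta * z * (- z / N%:R) + (1 + lambda) * e)).
  move=> /le_trans; apply.
  rewrite mulrC ler_wpM2r ?ler0n //; apply: le_trans drift _.
  by rewrite ler_wpM2l ?(ltW th_gt0) // gerBl ltW.
have We_ge0 : 0 <= W eta * e by rewrite mulr_ge0 // ltW.
case: onek => [->|[-> ->]].
  rewrite !mul0r addr0 oppr0 add0r mulNr ler_wpM2l ?ler0n // ler_wpM2l ?(ltW W_gt0) // lerD2l.
  by rewrite ler_peMl // lerDl ltW.
rewrite !mul1r le_eqVlt; apply/orP; left; rewrite -subr_eq0; apply/eqP.
transitivity (W eta * (2 * theta * z) * (lambda * (1 - rho) - rho)); last first.
  by rewrite rhoE subrr mulr0.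
set r := rho; by ring.
Qed.

Lemma add_active_size (xi : stable N) x :
  size (add_active (config_of_stable xi) (Some x)) = size (config_of_stable xi) + 1.
Proof. by rewrite /= config_sum_update site_size_arrive; ring. Qed.

Lemma add_active_excess (xi : stable N) x :
  Z (add_active (config_of_stable xi) (Some x)) =
  Z (config_of_stable xi) - site_excess rho (config_of_stable xi x).
Proof. by rewrite /= config_sum_update site_excess_arrive addr0. Qed.

(** The added particle shifts [Z] by [- Z / N] on average, so [gaussian_drift] applies. The term
    [- theta * W] is kept: it is the contraction that bounds the stationary mean. *)
Lemma gaussian_weight_driven (xi : stable N) :
  \sum_x N%:R^-1 * W (add_active (config_of_stable xi) (Some x)) <=
  W (config_of_stable xi) + theta * (C - W (config_of_stable xi)).
Proof.
set eta := config_of_stable xi; set z := Z eta.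
set e := 2 * theta + 16 * theta ^+ 2 * z ^+ 2.
have th_ge0 := ltW rate_theta_gt0; have W_ge0 : 0 <= W eta := expR_ge0 _.
have e_ge0 : 0 <= e.
  apply: addr_ge0; first exact: mulr_ge0.
  by rewrite -mulrA -exprMn mulr_ge0 // sqr_ge0.
have /andP[rho_ge0 rho_le1] := rho_itv.
apply: le_trans (lerD (lexx _) (gaussian_drift eta)); rewrite -/z -/e.
apply: (@le_trans _ _ (\sum_(x < N) N%:R^-1 *
    (W eta + W eta * (2 * theta * z * - site_excess rho (eta x) + e)))).
  apply: ler_sum => x _; rewrite ler_wpM2l ?invr_ge0 ?ler0n // -lerBlDl.
  apply: gaussian_weight_increment; first exact: add_active_excess.
  by rewrite normrN; case: (eta x) => [[|k]|] /=; rewrite ler_norml; apply/andP; split; lra.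
have -> : \sum_(x < N) N%:R^-1 *
    (W eta + W eta * (2 * theta * z * - site_excess rho (eta x) + e)) =
    W eta + W eta * (2 * theta * z * (- z / N%:R) + e).
  rewrite -mulr_sumr big_split /= -mulr_sumr big_split /= -mulr_sumr sumrN -/z.
  rewrite !sumr_const card_ord -[W eta *+ N]mulr_natl -[e *+ N]mulr_natl.
  rewrite -[\sum_i _]/z; set w := W eta; clearbody e w z.
  by field; rewrite lt0r_neq0.
by rewrite lerD2l ler_wpM2l // lerD2l ler_peMl // lerDl (ltW lambda_gt0).
Qed.

Lemma stationary_gaussian_moment (mu : stable N -> R) :
  is_stationary lambda mu ->
  \sum_xi mu xi * W (config_of_stable xi) <= C * (N%:R + 1).
Proof.
move=> mu_stat; have [mu_ge0 mu1 _] := mu_stat.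
have th_gt0 := rate_theta_gt0; have l_ge0 := ltW lambda_gt0.
have C_ge0 : 0 <= C.
  by rewrite mulr_ge0 ?expR_ge0 // addr_ge0 // mulr_ge0 // ltW.
(* Each active particle lowers the size at rate [1 / N], so the weight [D] offsets the growth
   [theta * C] of [W]. *)
pose D := theta * C * N%:R.
have D_ge0 : 0 <= D by rewrite mulr_ge0 ?ler0n // mulr_ge0 // ltW.
pose h (eta : config N) := D * size eta + W eta.
have h_ge0 eta : 0 <= h eta by rewrite addr_ge0 ?expR_ge0 // mulr_ge0 ?site_size_ge0.
have Lh eta : generator lambda h eta <= 0.
  rewrite /h (generator_linear lambda) generator_size.
  have := generator_gaussian eta; rewrite /D.
  set k := \sum_x _ => Wk.
  have -> : theta * C * N%:R * (- k / N%:R) = - (theta * C * k).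
    set a := theta * C; clearbody a; by field; rewrite lt0r_neq0.
  by rewrite addrC subr_le0.
have := stationary_sum_le l_ge0 mu_stat h_ge0 Lh.
set EW := \sum_xi mu xi * W _.
pose ET := \sum_xi mu xi * size (config_of_stable xi).
have -> : \sum_xi mu xi * h (config_of_stable xi) = D * ET + EW.
  rewrite mulr_sumr -big_split /=; apply: eq_bigr => xi _; rewrite /h; ring.
have step xi : \sum_x N%:R^-1 * h (add_active (config_of_stable xi) (Some x)) <=
    D * (size (config_of_stable xi) + 1) + W (config_of_stable xi)
    + theta * (C - W (config_of_stable xi)).
  rewrite -addrA -lerBlDl; apply: le_trans (gaussian_weight_driven xi).
  rewrite lerBlDl le_eqVlt; apply/orP; left; apply/eqP.
  under eq_bigr => x _ do rewrite /h mulrDr add_active_size.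
  rewrite big_split /= sumr_const card_ord -[X in X + _ = _]mulr_natl mulrA divff ?mul1r //.
  by rewrite lt0r_neq0.
move=> /le_trans /(_ (ler_sum _ (fun xi _ => ler_wpM2l (mu_ge0 xi) (step xi)))).
have -> : \sum_xi mu xi * (D * (size (config_of_stable xi) + 1) + W (config_of_stable xi)
    + theta * (C - W (config_of_stable xi))) = D * ET + D + EW + theta * (C - EW).
  transitivity (\sum_xi (D * (mu xi * size (config_of_stable xi))
      + (D + theta * C) * mu xi + (1 - theta) * (mu xi * W (config_of_stable xi)))).
    by apply: eq_bigr => xi _; ring.
  by rewrite !big_split /= -!mulr_sumr mu1 -/ET -/EW; ring.
(* [D * ET] and [EW] cancel from both sides, leaving [theta * EW <= D + theta * C]. *)
move=> H; have {}H : theta * EW <= theta * (C * (N%:R + 1)).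
  by move: H; rewrite /D; lra.
by rewrite -(ler_pM2l th_gt0).
Qed.

Lemma stationary_tail (mu : stable N -> R) (a : R) :
  is_stationary lambda mu -> 0 <= a ->
  \sum_(xi | ~~ (rho * N%:R - a <= (num_particles xi)%:R <= rho * N%:R + a)) mu xi
    <= expR (- (theta * a ^+ 2)) * (C * (N%:R + 1)).
Proof.
move=> mu_stat a_ge0; have [mu_ge0 _ _] := mu_stat.
apply: le_trans (ler_wpM2l (expR_ge0 _) (stationary_gaussian_moment mu_stat)).
rewrite mulr_sumr big_mkcond; apply: ler_sum => xi _.
have W_ge0 : 0 <= W (config_of_stable xi) := expR_ge0 _.
case: ifP => [out|_]; last by rewrite !mulr_ge0 ?expR_ge0.
rewrite mulrCA ler_peMr // /gaussian_weight -expRD -[leLHS]expR0 ler_expR addrC subr_ge0.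
rewrite ler_wpM2l ?(ltW rate_theta_gt0) //.
(* With no active particle, every site contributes its occupation minus [rho]. *)
have -> : Z (config_of_stable xi) = (num_particles xi)%:R - rho * N%:R.
  have -> : rho * N%:R = \sum_(x < N) rho by rewrite sumr_const card_ord mulr_natr.
  rewrite /config_sum /num_particles natr_sum -sumrB.
  by apply: eq_bigr => x _; rewrite ffunE; case: (xi x); rewrite ?sub0r.
set y := _%:R in out *; set b := rho * _ in out *.
by move: out; rewrite negb_and -!ltNge => /orP[] ?; nra.
Qed.
End Drift.

(** * Concentration of the number of particles *)

Lemma mass_itv_particle_law (R : realType) (N : nat) (mu : stable N -> R) (a b : R) :
  mass_itv (particle_law mu) a b = \sum_(xi | a <= (num_particles xi)%:R <= b) mu xi.
Proof.
have num_lt (xi : stable N) : (num_particles xi < N.+1)%N.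
  rewrite ltnS /num_particles -[leqRHS]card_ord -sum1_card.
  by apply: leq_sum => x _; case: (xi x).
rewrite (partition_big (fun xi => Ordinal (num_lt xi))
  (fun n : 'I_N.+1 => a <= n%:R <= b)) //=.
apply: eq_bigr => n n_in; apply: eq_bigl => xi; rewrite -val_eqE /=.
by case: eqP => [->|]; rewrite ?andbF // n_in.
Qed.

Theorem theorem1p1 (R : realType) (lambda : R) (lambda_gt0 : 0 < lambda) :
  let rho_c : R := lambda / (1 + lambda) in
  exists alpha : nat -> R,
    (alpha =O_\oo (fun N : nat => Num.sqrt (N%:R * ln (N%:R : R)))) /\
    (forall mubar : (forall N : nat, stable N -> R),
       (forall N : nat, (0 < N)%N -> is_stationary lambda (mubar N)) ->
       (fun N : nat => mass_itv (particle_law (mubar N))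
                         (rho_c * N%:R - alpha N) (rho_c * N%:R + alpha N))
         @ \oo --> (1 : R)).
Proof.
move=> rho_c.
have l_gt0 : 0 < 1 + lambda by rewrite addr_gt0.
have l_ge0 := ltW l_gt0.
(* The factor 32 gives [theta * a N ^+ 2 = 2 * ln N], so the tail factor [N ^ -2] beats the moment
   bound of order [N]. *)
pose a N := Num.sqrt (32 * (1 + lambda)) * Num.sqrt (N%:R * ln (N%:R : R)).
exists a; split.
  apply/eqO_exP; exists (Num.sqrt (32 * (1 + lambda))); first by rewrite sqrtr_gt0 mulr_gt0.
  by near=> N; rewrite normrM ger0_norm ?sqrtr_ge0.
move=> mubar mu_stat.
have C_ge0 : 0 <= drift_bound lambda.
  by rewrite mulr_ge0 ?expR_ge0 // addr_ge0 // mulr_ge0.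
apply: (@squeeze_cvgr _ _ _ _ (fun N => 1 - 4 * drift_bound lambda * N.+1%:R^-1) (fun=> 1)).
- near=> N; have N_gt0 : (0 < N)%N by near: N; exact: nbhs_infty_gt.
  have [mu_ge0 mu1 _] := mu_stat N N_gt0.
  rewrite mass_itv_particle_law.
  move: mu1; rewrite (bigID
    (fun xi => rho_c * N%:R - a N <= (num_particles xi)%:R <= rho_c * N%:R + a N)) /=.
  set inside := (X in X + _ = _); set outside := (X in _ + X = _) => mu1.
  have out_ge0 : 0 <= outside by exact: sumr_ge0.
  suff : outside <= 4 * drift_bound lambda / N.+1%:R.
    move=> out_le; apply/andP; split; last by rewrite -[leRHS]mu1 lerDl.
    by rewrite lerBlDr -[leLHS]mu1 lerD2l.
  apply: le_trans (stationary_tail lambda_gt0 N_gt0 (mu_stat N N_gt0) _) _.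
    by rewrite mulr_ge0 ?sqrtr_ge0.
  have N_gt0' : 0 < N%:R :> R by rewrite ltr0n.
  have lnN : 0 <= ln N%:R :> R by rewrite ln_ge0 // ler1n.
  have -> : rate_theta lambda N * a N ^+ 2 = 2 * ln N%:R.
    rewrite /a /rate_theta exprMn !sqr_sqrtr ?mulr_ge0 ?ler0n //.
    by field; rewrite !lt0r_neq0.
  rewrite expRN expRM_natl lnK ?posrE // -natr1.
  have N_ge1 : 1 <= N%:R :> R by rewrite ler1n.
  rewrite ler_pdivlMr ?addr_gt0 // -mulrA mulrAC -mulrA.
  rewrite [X in X <= _]mulrC ler_pdivrMr ?exprn_gt0 //.
  (* This is the source of the 4 in the lower bound of the squeeze. *)
  have : (N%:R + 1) * (N%:R + 1) <= 4 * N%:R ^+ 2 :> R by nra.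
  by move=> /(ler_wpM2l C_ge0); lra.
- rewrite -[X in _ --> X]subr0; apply: cvgB; first exact: cvg_cst.
  rewrite -[X in _ --> X](mulr0 (4 * drift_bound lambda)).
  by apply: cvgMr; exact: cvg_harmonic.
- exact: cvg_cst.
Unshelve. all: by end_near. Qed.
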